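(* Let $\{a,b,c\}$ with $a<b<c$ be a $D(4)$-triple, and let $r=\sqrt{ab+4}$, $s=\sqrt{ac+4}$, $t=\sqrt{bc+4}$. Then $r,s,t$ are the side lengths of a non-degenerate Euclidean triangle if and only if $\{a,b,c\}$ is regular and $r>b-a$.
   Context: A $D(4)$-triple is a set of three distinct positive integers such that the product of any two distinct elements, increased by $4$, is a perfect square. A $D(4)$-triple $\{a,b,c\}$ with $a<b<c$ is called regular if $c=a+b+2r$, where $r=\sqrt{ab+4}$. The numbers $r,s,t$ are positive integers with $r<s<t$, so they are the side lengths of a non-degenerate triangle exactly when $r+s>t$. *)

(* Defs.v *)
From Stdlib Require Import ZArith Reals.

Definition perfect_square (n : Z) : Prop := exists k : Z, n = (k * k)%Z.

(* The unordered set {a, b, c}: the definition is symmetric in a, b, c. *)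
Definition D4_triple (a b c : Z) : Prop :=
  (0 < a /\ 0 < b /\ 0 < c)%Z /\
  (a <> b /\ a <> c /\ b <> c) /\
  perfect_square (a * b + 4) /\
  perfect_square (a * c + 4) /\
  perfect_square (b * c + 4).

(* Unlike D4_triple, this depends on the order of the arguments. *)
Definition D4_regular (a b c : Z) : Prop :=
  D4_triple a b c /\ (a < b < c)%Z /\
  (IZR c = IZR a + IZR b + 2 * sqrt (IZR (a * b + 4)))%R.

Definition collinear (x0 y0 x1 y1 x2 y2 : R) : Prop :=
  ((x1 - x0) * (y2 - y0) - (x2 - x0) * (y1 - y0) = 0)%R.

Definition triangle_sides (r s t : R) : Prop :=
  exists x0 y0 x1 y1 x2 y2 : R,
    ~ collinear x0 y0 x1 y1 x2 y2 /\
    dist_euc x0 y0 x1 y1 = r /\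
    dist_euc x1 y1 x2 y2 = s /\
    dist_euc x2 y2 x0 y0 = t.

(* Main.v *)
(* If c <> a + b + 2r, the number d = a + b + c + (abc - rst)/2 is a positive
   integer extending the triple downwards: ad + 4 = x^2 and bd + 4 = y^2 with
   x = (rs - at)/2 and y = (rt - bs)/2.  Inverting, 2s = ay + rx and
   2t = bx + ry, so 2(t - s - r) = r(y - x - 2) + (bx - ay), and d(b - a) = y^2 - x^2 with
   x < y integers makes the right-hand side nonnegative; hence t >= r + s.
   If c = a + b + 2r, then s = a + r and t = b + r, so that r + s > t is
   r > b - a. *)
Require Import Defs.
From Stdlib Require Import ZArith Reals Lia Lra.

(** * Integer arithmetic of the downward extension d *)

Open Scope Z_scope.

Lemma even_sqrt_add4 (n m : Z) : n * n = m + 4 -> Z.even n = Z.even m.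
Proof.
  intros H. apply (f_equal Z.even) in H.
  rewrite Z.even_mul, Z.even_add in H. change (Z.even 4) with true in H.
  destruct (Z.even n), (Z.even m); simpl in H; congruence.
Qed.

(** Expanding (rs - at)^2 leaves the product rst only linearly, exactly as it occurs in 2d.
    Permuting a, b, c gives the same for bd + 4 and cd + 4. *)
Lemma D4_extension_square (a b c r s t d x : Z) :
  r * r = a * b + 4 -> s * s = a * c + 4 -> t * t = b * c + 4 ->
  2 * d = 2 * (a + b + c) + a * b * c - r * s * t ->
  2 * x = r * s - a * t ->
  x * x = a * d + 4.
Proof.
  intros Hr Hs Ht Hd Hx.
  enough (4 * (x * x) = 4 * (a * d + 4)) by lia.
  replace (4 * (x * x)) with ((2 * x) * (2 * x)) by ring.
  replace (4 * (a * d + 4)) with (2 * a * (2 * d) + 16) by ring.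
  rewrite Hx, Hd.
  replace ((r * s - a * t) * (r * s - a * t))
    with ((r * r) * (s * s) + a * a * (t * t) - 2 * a * (r * s * t)) by ring.
  rewrite Hr, Hs, Ht. ring.
Qed.

(** (rs)^2 - (at)^2 = 4a(b + c - a) + 16 is positive. *)
Lemma D4_extension_root_pos (a b c r s t x : Z) :
  0 < a -> a < b + c -> 0 < r -> 0 < s ->
  r * r = a * b + 4 -> s * s = a * c + 4 -> t * t = b * c + 4 ->
  2 * x = r * s - a * t ->
  0 < x.
Proof.
  intros Ha Hbc Hr0 Hs0 Hr Hs Ht Hx.
  enough (a * t < r * s) by lia.
  apply Z.square_lt_simpl_nonneg; [nia|].
  replace ((r * s) * (r * s)) with ((r * r) * (s * s)) by ring.
  replace ((a * t) * (a * t)) with (a * a * (t * t)) by ring.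
  rewrite Hr, Hs, Ht. nia.
Qed.

(** Serves to exclude d < 0. The only candidates 6, 7, 10 lie strictly between consecutive
    squares. *)
Lemma no_D4_pair_le3 (a b r : Z) :
  0 < a -> a < b -> b <= 3 -> r * r <> a * b + 4.
Proof.
  intros Ha Hab Hb Hr.
  assert (Hn : forall n k, k * k < n -> n < (k + 1) * (k + 1) -> 0 <= k ->
    forall m, m * m <> n).
  { intros n k H1 H2 Hk m <-.
    assert (k < Z.abs m) by nia. assert (Z.abs m < k + 1) by nia. lia. }
  assert (H : (a = 1 /\ b = 2) \/ (a = 1 /\ b = 3) \/ (a = 2 /\ b = 3)) by lia.
  destruct H as [[-> ->]|[[-> ->]|[-> ->]]].
  - now apply (Hn 6 2) in Hr.
  - now apply (Hn 7 2) in Hr.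
  - now apply (Hn 10 3) in Hr.
Qed.

(* With y = x + 1 the claim (b - a) x - a >= r becomes, after multiplying by d
   and squaring, 16ad + 68 + 16x >= 4d^2; this follows from d <= 2x + 1, which
   is d <= d(b - a). *)
Lemma consecutive_roots_gap (a b r d x : Z) :
  0 < a -> a < b -> 0 < d -> 0 < x -> 0 < r ->
  r * r = a * b + 4 -> x * x = a * d + 4 ->
  d * (b - a) = 2 * x + 1 ->
  r <= (b - a) * x - a.
Proof.
  intros Ha Hab Hd Hx Hr0 Hr Hxx Hdb.
  set (w := (b - a) * x - a).
  assert (Hw : d * w = a * d + 8 + x).
  { unfold w.
    replace (d * ((b - a) * x - a)) with (d * (b - a) * x - a * d) by ring.
    rewrite Hdb. nia. }
  assert (Hdx : d <= 2 * x + 1) by nia.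
  enough (d * r <= d * w) by nia.
  apply Z.square_le_simpl_nonneg; [nia|].
  assert (Hdr : (d * r) * (d * r) = a * d * (a * d) + a * d * (2 * x + 1) + 4 * (d * d)).
  { replace ((d * r) * (d * r)) with (d * d * (r * r)) by ring.
    rewrite Hr, <- Hdb. ring. }
  rewrite Hdr, Hw.
  nia.
Qed.

Lemma D4_extension_gap (a b r d x y : Z) :
  0 < a -> a < b -> 0 < d -> 0 < x -> 0 < y -> 0 < r ->
  r * r = a * b + 4 -> x * x = a * d + 4 -> y * y = b * d + 4 ->
  2 * r <= r * (y - x) + (b * x - a * y).
Proof.
  intros Ha Hab Hd Hx Hy Hr0 Hr Hxx Hyy.
  assert (Hxy : x < y) by nia.
  (* If y - x >= 2, the first summand alone reaches 2r and bx > ay suffices; if y = x + 1 it gives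
     only r, and bx - ay must supply the other r. *)
  destruct (Z.eq_dec y (x + 1)) as [->|Hne].
  - assert (r <= (b - a) * x - a)
      by (apply (consecutive_roots_gap a b r d x); auto; lia).
    nia.
  - assert (a * y < b * x).
    { apply Z.square_lt_simpl_nonneg; [nia|].
      replace ((a * y) * (a * y)) with (a * a * (y * y)) by ring.
      replace ((b * x) * (b * x)) with (b * b * (x * x)) by ring.
      rewrite Hxx, Hyy.
      enough (0 < (b - a) * (a * b * d + 4 * (a + b))) by lia.
      apply Z.mul_pos_pos; [lia|]. nia. }
    assert (2 * r <= r * (y - x)) by nia.
    lia.
Qed.

Lemma D4_regular_of_triangle (a b c r s t : Z) :
  0 < a -> a < b -> b < c -> 0 < r -> 0 < s -> 0 < t ->
  r * r = a * b + 4 -> s * s = a * c + 4 -> t * t = b * c + 4 ->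
  t < r + s -> c = a + b + 2 * r.
Proof.
  intros Ha Hab Hbc Hr0 Hs0 Ht0 Hr Hs Ht Htri.
  pose proof (even_sqrt_add4 _ _ Hr) as Er.
  pose proof (even_sqrt_add4 _ _ Hs) as Es.
  pose proof (even_sqrt_add4 _ _ Ht) as Et.
  rewrite Z.even_mul in Er, Es, Et.
  (* The parities of r, s, t are those of ab, ac, bc, so each halving is checked on the parities of
     a, b, c. *)
  assert (Hx : Z.even (r * s - a * t) = true).
  { rewrite Z.even_sub, !Z.even_mul, Er, Es, Et.
    destruct (Z.even a), (Z.even b), (Z.even c); reflexivity. }
  assert (Hy : Z.even (r * t - b * s) = true).
  { rewrite Z.even_sub, !Z.even_mul, Er, Es, Et.
    destruct (Z.even a), (Z.even b), (Z.even c); reflexivity. }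
  assert (Hz : Z.even (s * t - c * r) = true).
  { rewrite Z.even_sub, !Z.even_mul, Er, Es, Et.
    destruct (Z.even a), (Z.even b), (Z.even c); reflexivity. }
  assert (Hd : Z.even (a * b * c - r * s * t) = true).
  { rewrite Z.even_sub, !Z.even_mul, Er, Es, Et.
    destruct (Z.even a), (Z.even b), (Z.even c); reflexivity. }
  apply Z.even_spec in Hx as [x Hx], Hy as [y Hy], Hz as [z Hz], Hd as [k Hk].
  set (d := a + b + c + k).
  assert (Hxx : x * x = a * d + 4).
  { apply (D4_extension_square a b c r s t); unfold d; lia. }
  assert (Hyy : y * y = b * d + 4).
  { apply (D4_extension_square b a c r t s); unfold d; lia. }
  assert (Hzz : z * z = c * d + 4).
  { apply (D4_extension_square c a b s t r); unfold d; lia. }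
  assert (Hx0 : 0 < x).
  { apply (D4_extension_root_pos a b c r s t); lia. }
  assert (Hy0 : 0 < y).
  { apply (D4_extension_root_pos b a c r t s); lia. }
  (* The equations for 2x and 2y are linear in s, t with determinant r^2 - ab = 4. *)
  assert (H2s : 2 * s = a * y + r * x).
  { enough (2 * (2 * s) = 2 * (a * y + r * x)) by lia.
    replace (2 * (a * y + r * x)) with (a * (2 * y) + r * (2 * x)) by ring.
    rewrite <- Hx, <- Hy.
    replace (a * (r * t - b * s) + r * (r * s - a * t))
      with (s * (r * r - a * b)) by ring.
    rewrite Hr. ring. }
  assert (H2t : 2 * t = b * x + r * y).
  { enough (2 * (2 * t) = 2 * (b * x + r * y)) by lia.
    replace (2 * (b * x + r * y)) with (b * (2 * x) + r * (2 * y)) by ring.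
    rewrite <- Hx, <- Hy.
    replace (b * (r * s - a * t) + r * (r * t - b * s))
      with (t * (r * r - a * b)) by ring.
    rewrite Hr. ring. }
  destruct (Z.lt_trichotomy d 0) as [Hneg|[H0|Hpos]].
  (* For d < 0, z^2 = cd + 4 >= 0 forces c <= 4, hence b <= 3. *)
  - exfalso. apply (no_D4_pair_le3 a b r); auto.
    pose proof (Z.square_nonneg z) as Hz0.
    clear - Hzz Hneg Hab Hbc Ha Hz0. nia.
  (* For d = 0, x = y = 2 gives s = a + r; cancelling a in (a + r)^2 = ac + 4 yields regularity. *)
  - rewrite H0 in Hxx, Hyy.
    assert (x = 2) by (clear - Hxx Hx0; nia).
    assert (y = 2) by (clear - Hyy Hy0; nia).
    subst x y.
    assert (s = a + r) by lia. subst s.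
    apply (Z.mul_reg_l _ _ a); lia.
  - exfalso.
    pose proof (D4_extension_gap a b r d x y Ha Hab Hpos Hx0 Hy0 Hr0 Hr Hxx Hyy)
      as Hgap.
    clear - Hgap H2s H2t Htri. lia.
Qed.

(** * Euclidean triangles and the triangle inequality *)

Open Scope R_scope.

(** By Lagrange's identity a nonzero cross product makes the dot product of two edge vectors
    strictly less than rs, so t^2 < (r + s)^2. *)
Lemma triangle_sides_lt (r s t : R) : triangle_sides r s t -> t < r + s.
Proof.
  intros (x0 & y0 & x1 & y1 & x2 & y2 & Hnc & Hr & Hs & Ht).
  unfold collinear in Hnc. unfold dist_euc in *.
  assert (Hr0 : 0 <= r) by (rewrite <- Hr; apply sqrt_pos).
  assert (Hs0 : 0 <= s) by (rewrite <- Hs; apply sqrt_pos).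
  assert (Ht0 : 0 <= t) by (rewrite <- Ht; apply sqrt_pos).
  apply (f_equal Rsqr) in Hr, Hs, Ht.
  rewrite Rsqr_sqrt in Hr, Hs, Ht
    by (apply Rplus_le_le_0_compat; apply Rle_0_sqr).
  unfold Rsqr in *.
  set (cross := (x1 - x0) * (y2 - y0) - (x2 - x0) * (y1 - y0)) in *.
  set (dot := (x1 - x0) * (x2 - x1) + (y1 - y0) * (y2 - y1)).
  assert (Hlag : (r * s) * (r * s) = dot * dot + cross * cross).
  { replace ((r * s) * (r * s)) with ((r * r) * (s * s)) by ring.
    rewrite <- Hr, <- Hs. unfold dot, cross. ring. }
  assert (Htt : t * t = r * r + s * s + 2 * dot).
  { rewrite <- Hr, <- Hs, <- Ht. unfold dot. ring. }
  assert (0 < cross * cross) by (apply Rsqr_pos_lt; exact Hnc).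
  assert (0 <= r * s) by (apply Rmult_le_pos; assumption).
  assert (dot < r * s) by nra.
  nra.
Qed.

(** Side r is laid from (0, 0) to (r, 0). The law of cosines gives the abscissa [u] of the third
    vertex; its squared height, times 4r^2, is Heron's product of four positive factors. *)
Lemma triangle_sides_intro (r s t : R) :
  0 < r -> t < r + s -> s < r + t -> r < s + t -> triangle_sides r s t.
Proof.
  intros Hr H1 H2 H3.
  set (u := (t * t + r * r - s * s) / (2 * r)).
  assert (Hu : 2 * r * u = t * t + r * r - s * s) by (unfold u; field; lra).
  assert (Hv : 0 < t * t - u * u).
  { enough (0 < (2 * r) * (2 * r) * (t * t - u * u)).
    { apply Rmult_lt_reg_l with ((2 * r) * (2 * r)); nra. }
    replace ((2 * r) * (2 * r) * (t * t - u * u))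
      with ((2 * r * t - 2 * r * u) * (2 * r * t + 2 * r * u)) by ring.
    rewrite Hu. apply Rmult_lt_0_compat.
    - replace (2 * r * t - (t * t + r * r - s * s))
        with ((s + t - r) * (r + s - t)) by ring.
      apply Rmult_lt_0_compat; lra.
    - replace (2 * r * t + (t * t + r * r - s * s))
        with ((r + t - s) * (r + s + t)) by ring.
      apply Rmult_lt_0_compat; lra. }
  pose proof (sqrt_lt_R0 _ Hv) as Hv0.
  pose proof (sqrt_sqrt _ (Rlt_le _ _ Hv)) as Hvv.
  set (v := sqrt (t * t - u * u)) in *.
  exists 0, 0, r, 0, u, v. unfold collinear, dist_euc, Rsqr.
  repeat split.
  - nra.
  - replace ((0 - r) * (0 - r) + (0 - 0) * (0 - 0)) with (r * r) by ring.
    apply sqrt_square. lra.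
  - replace ((r - u) * (r - u) + (0 - v) * (0 - v)) with (s * s) by lra.
    apply sqrt_square. lra.
  - replace ((u - 0) * (u - 0) + (v - 0) * (v - 0)) with (t * t) by lra.
    apply sqrt_square. lra.
Qed.

(** * Passage between real roots and integers *)

Lemma sqrt_IZR_perfect_square (n : Z) :
  (0 < n)%Z -> perfect_square n ->
  exists k : Z, (0 < k)%Z /\ (k * k = n)%Z /\ sqrt (IZR n) = IZR k.
Proof.
  intros Hn [k ->]. exists (Z.abs k).
  repeat split; [nia|nia|].
  rewrite <- Z.abs_square, mult_IZR. apply sqrt_square, IZR_le. lia.
Qed.

Theorem theorem3p2 (a b c : Z) (r s t : R)
  (hD : D4_triple a b c) (hab : (a < b)%Z) (hbc : (b < c)%Z)
  (hr : r = sqrt (IZR (a * b + 4)))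
  (hs : s = sqrt (IZR (a * c + 4)))
  (ht : t = sqrt (IZR (b * c + 4))) :
  triangle_sides r s t <->
  D4_regular a b c /\ (r > IZR b - IZR a)%R.
Proof.
  pose proof hD as ((Ha & _ & _) & _ & Sr & Ss & St).
  apply sqrt_IZR_perfect_square in Sr as (r0 & Hr0 & Hrr & Er); [|nia].
  apply sqrt_IZR_perfect_square in Ss as (s0 & Hs0 & Hss & Es); [|nia].
  apply sqrt_IZR_perfect_square in St as (t0 & Ht0 & Htt & Et); [|nia].
  rewrite Es in hs. rewrite Et in ht.
  unfold D4_regular. rewrite Er in hr |- *. subst r s t.
  (* For regular c, ac + 4 = (a + r)^2 and bc + 4 = (b + r)^2; positivity selects the roots. *)
  assert (Hst : (c = a + b + 2 * r0 -> s0 = a + r0 /\ t0 = b + r0)%Z).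
  { intros ->. split; nia. }
  split.
  - intros Htri. apply triangle_sides_lt in Htri.
    rewrite <- plus_IZR in Htri. apply lt_IZR in Htri.
    assert (Hc : (c = a + b + 2 * r0)%Z)
      by (apply (D4_regular_of_triangle a b c r0 s0 t0); assumption).
    destruct (Hst Hc) as [-> ->].
    split; [split; [exact hD|split; [lia|]]|].
    + rewrite Hc, !plus_IZR, mult_IZR. reflexivity.
    + rewrite <- minus_IZR. apply IZR_lt. lia.
  - intros [(_ & _ & Hc) Hgt].
    rewrite <- mult_IZR, <- !plus_IZR in Hc. apply eq_IZR in Hc.
    rewrite <- minus_IZR in Hgt. apply lt_IZR in Hgt.
    destruct (Hst Hc) as [-> ->].
    apply triangle_sides_intro;
      rewrite <- ?plus_IZR; apply IZR_lt; lia.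
Qed.
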